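(* Let $\sigma,\sigma'\in\mathcal{L}$ be two switching signals, let $\mathbf{K}^{\sigma},\mathbf{K}^{\sigma'}$ be block lower triangular controller matrices associated with them, and let $\mathbf{\Phi}^{\sigma}_{xx},\mathbf{\Phi}^{\sigma}_{xy},\mathbf{\Phi}^{\sigma}_{ux},\mathbf{\Phi}^{\sigma}_{uy}$ and $\mathbf{\Phi}^{\sigma'}_{xx},\mathbf{\Phi}^{\sigma'}_{xy},\mathbf{\Phi}^{\sigma'}_{ux},\mathbf{\Phi}^{\sigma'}_{uy}$ be the corresponding system response maps. Then the following two conditions are equivalent: (i) for every $t\in\{0,\dots,T\}$ with $\sigma_{0:t}=\sigma'_{0:t}$, one has $\mathbf{K}^{\sigma}(:t)=\mathbf{K}^{\sigma'}(:t)$; (ii) for every $t\in\{0,\dots,T\}$ with $\sigma_{0:t}=\sigma'_{0:t}$, one has $\mathbf{\Phi}^{\sigma}_{xx}(:t)=\mathbf{\Phi}^{\sigma'}_{xx}(:t)$, $\mathbf{\Phi}^{\sigma}_{xy}(:t)=\mathbf{\Phi}^{\sigma'}_{xy}(:t)$, $\mathbf{\Phi}^{\sigma}_{ux}(:t)=\mathbf{\Phi}^{\sigma'}_{ux}(:t)$ and $\mathbf{\Phi}^{\sigma}_{uy}(:t)=\mathbf{\Phi}^{\sigma'}_{uy}(:t)$.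
   Context: Fix a horizon $T\ge 0$, dimensions $n,p,m$, and a number of modes $M$. For each mode $i\in\{1,\dots,M\}$ and time $t\in\{0,\dots,T\}$ there are real matrices $A^i_t\in\mathbb{R}^{n\times n}$, $B^i_t\in\mathbb{R}^{n\times p}$, $C^i_t\in\mathbb{R}^{m\times n}$. A switching signal is a function $\sigma:\{0,\dots,T\}\to\{1,\dots,M\}$, written $t\mapsto\sigma_t$; its prefix at time $t$ is $\sigma_{0:t}=(\sigma_0,\dots,\sigma_t)$. The language $\mathcal{L}$ is a given set of switching signals. The switched system is $x_{t+1}=A_t^{\sigma_t}x_t+B_t^{\sigma_t}u_t+w_t^{\sigma_t}$, $y_t=C_t^{\sigma_t}x_t+v_t^{\sigma_t}$. For a switching signal $\sigma$ define the block diagonal matrices $\mathbf{A}^{\sigma}=\mathrm{blkdiag}\{A_0^{\sigma_0},\dots,A_{T-1}^{\sigma_{T-1}},\mathbf{0}\}$, $\mathbf{B}^{\sigma}=\mathrm{blkdiag}\{B_0^{\sigma_0},\dots,B_{T-1}^{\sigma_{T-1}},\mathbf{0}\}$, $\mathbf{C}^{\sigma}=\mathrm{blkdiag}\{C_0^{\sigma_0},\dots,C_T^{\sigma_T}\}$ (the trailing zero blocks have sizes $n\times n$ and $n\times p$), each with $(T+1)\times(T+1)$ blocks. Let $\mathcal{Z}\in\mathbb{R}^{n(T+1)\times n(T+1)}$ be the block downshift operator: $T$ copies of $I_n$ on the first block subdiagonal and zeros elsewhere. A controller matrix $\mathbf{K}^{\sigma}\in\mathbb{R}^{p(T+1)\times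 m(T+1)}$ is a block lower triangular matrix whose $(t,\tau)$ block is $K^{\sigma}_{(t,\tau)}\in\mathbb{R}^{p\times m}$ for $\tau\le t$ and zero for $\tau>t$; it represents the output feedback $u_t=\sum_{\tau\le t}K^{\sigma}_{(t,\tau)}y_\tau$. The corresponding system response maps are $\mathbf{\Phi}^{\sigma}_{xx}=(I-\mathcal{Z}(\mathbf{A}^{\sigma}+\mathbf{B}^{\sigma}\mathbf{K}^{\sigma}\mathbf{C}^{\sigma}))^{-1}$, $\mathbf{\Phi}^{\sigma}_{xy}=\mathbf{\Phi}^{\sigma}_{xx}\mathcal{Z}\mathbf{B}^{\sigma}\mathbf{K}^{\sigma}$, $\mathbf{\Phi}^{\sigma}_{ux}=\mathbf{K}^{\sigma}\mathbf{C}^{\sigma}\mathbf{\Phi}^{\sigma}_{xx}$, $\mathbf{\Phi}^{\sigma}_{uy}=\mathbf{K}^{\sigma}+\mathbf{K}^{\sigma}\mathbf{C}^{\sigma}\mathbf{\Phi}^{\sigma}_{xx}\mathcal{Z}\mathbf{B}^{\sigma}\mathbf{K}^{\sigma}$; they are block lower triangular with $(T+1)\times(T+1)$ blocks of sizes $n\times n$, $n\times m$, $p\times n$, $p\times m$ respectively. For a block lower triangular matrix $\mathbf{M}$ with block rows and columns indexed from $0$, $\mathbf{M}(:t)$ denotes the submatrix consisting of its first $t+1$ block rows and first $t+1$ block columns. *)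

(* Defs.v *)
From HB Require Import structures.
From mathcomp Require Import all_boot all_order all_algebra.
From mathcomp Require Import reals.

Set Implicit Arguments.
Unset Strict Implicit.
Unset Printing Implicit Defensive.

Import GRing.Theory.
Local Open Scope ring_scope.

(* k x k block matrices with all blocks of size a x b, in the shape expected by
   \mxblock and submxblock *)
Notation "''BM[' R ]_ ( k , a , b )" :=
  'M[R]_(\sum_(i < k) a, \sum_(j < k) b)
  (at level 8, R at level 2).

(* sigma t is the mode active at time t; horizon T, modes numbered from 0 *)
Notation signal T M := {ffun 'I_T.+1 -> 'I_M}.

Section Blocks.

Variable R : realType.

(* \mxdiag only covers square blocks *)
Definition blkdiag k a b (D : 'I_k -> 'M[R]_(a, b)) : 'BM[R]_(k, a, b) :=
  \mxblock_(i < k, j < k) (if i == j then D i else 0).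

Definition blk_lower_trig k a b (X : 'BM[R]_(k, a, b)) : Prop :=
  forall i j : 'I_k, (i < j)%N -> submxblock X i j = 0.

Definition downshift k n : 'BM[R]_(k, n, n) :=
  \mxblock_(i < k, j < k) (if i == j.+1 :> nat then 1%:M else 0 : 'M[R]_n).

(* X(:t), of t + 1 block rows and columns; ltn_ord t : t < k is t.+1 <= k *)
Definition leading k a b (X : 'BM[R]_(k, a, b)) (t : 'I_k) :
    'BM[R]_(t.+1, a, b) :=
  \mxblock_(i < t.+1, j < t.+1)
    submxblock X (widen_ord (ltn_ord t) i) (widen_ord (ltn_ord t) j).

End Blocks.

Definition sig_prefix T M (sigma : signal T M) (t : 'I_T.+1) :
    {ffun 'I_t.+1 -> 'I_M} :=
  [ffun s => sigma (widen_ord (ltn_ord t) s)].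

Section SystemResponse.

Variables (R : realType) (T n p m M : nat).
Variable A : 'I_M -> 'I_T.+1 -> 'M[R]_(n, n).
Variable B : 'I_M -> 'I_T.+1 -> 'M[R]_(n, p).
Variable C : 'I_M -> 'I_T.+1 -> 'M[R]_(m, n).

Definition blkA (sigma : signal T M) : 'BM[R]_(T.+1, n, n) :=
  blkdiag (fun t : 'I_T.+1 => if (t < T)%N then A (sigma t) t else 0).

Definition blkB (sigma : signal T M) : 'BM[R]_(T.+1, n, p) :=
  blkdiag (fun t : 'I_T.+1 => if (t < T)%N then B (sigma t) t else 0).

Definition blkC (sigma : signal T M) : 'BM[R]_(T.+1, m, n) :=
  blkdiag (fun t : 'I_T.+1 => C (sigma t) t).

Variables (sigma : signal T M) (K : 'BM[R]_(T.+1, p, m)).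

Local Notation Z := (downshift R T.+1 n).

(* For block lower triangular K the argument of invmx is lower triangular with
   unit diagonal, so invmx is a genuine inverse. *)
Definition Phi_xx : 'BM[R]_(T.+1, n, n) :=
  invmx (1%:M - Z *m (blkA sigma + blkB sigma *m K *m blkC sigma)).

Definition Phi_xy : 'BM[R]_(T.+1, n, m) :=
  Phi_xx *m Z *m blkB sigma *m K.

Definition Phi_ux : 'BM[R]_(T.+1, p, n) :=
  K *m blkC sigma *m Phi_xx.

Definition Phi_uy : 'BM[R]_(T.+1, p, m) :=
  K + K *m blkC sigma *m Phi_xx *m Z *m blkB sigma *m K.

End SystemResponse.

(* Main.v *)
Require Import Defs.
From HB Require Import structures.
From mathcomp Require Import all_boot all_order all_algebra.
From mathcomp Require Import reals.

Set Implicit Arguments.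
Unset Strict Implicit.
Unset Printing Implicit Defensive.

Import GRing.Theory.
Local Open Scope ring_scope.

(** On block lower triangular matrices, truncation X |-> X(:t) is a ring
    morphism ([leadingM], [leading1]): an entry of a product in the first t + 1
    block rows only involves the first t + 1 block columns of the left factor.
    Hence any identity between causal matrices may be read on truncations, and
    the truncation of an inverse is determined by that of the matrix
    ([leading_inverse]).

    The matrix W = I - Z(A + BKC) is I minus a strictly lower triangular, thus
    nilpotent, matrix; so it is invertible and its inverse Phi_xx, a finite
    Neumann sum, is again lower triangular.  The truncations of A, B, C at t
    depend only on the prefix of the signal up to t.  Therefore, for each t at
    which the prefixes agree:
    - the four maps are built from A, B, C, K by sums, products and the inverse
      of W, so their truncations are determined by K(:t);
    - conversely K = Phi_uy - Phi_ux W Phi_xy with W the inverse of Phi_xx, so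
      K(:t) is determined by the truncations of the four maps.
    The equivalence holds for each t separately. *)

(** * Banded block matrices *)

Section Band.

Variable R : realType.

(** The zero blocks reach down to the d-th block subdiagonal, excluded.  Lower
    triangular is [band 0] and strictly lower triangular is [band 1]; the
    grading by d makes nilpotency a consequence of [band_mul]. *)
Definition band d k a b (X : 'BM[R]_(k, a, b)) : Prop :=
  forall i j : 'I_k, (i < j + d)%N -> submxblock X i j = 0.

Lemma band0P k a b (X : 'BM[R]_(k, a, b)) : blk_lower_trig X <-> band 0 X.
Proof. by split=> h i j; have := h i j; rewrite addn0. Qed.

Lemma bandW d k a b (X : 'BM[R]_(k, a, b)) : band d X -> band 0 X.
Proof.
by move=> h i j; rewrite addn0 => ij; rewrite h // (leq_trans ij) ?leq_addr.
Qed.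

Lemma bandD d k a b (X Y : 'BM[R]_(k, a, b)) :
  band d X -> band d Y -> band d (X + Y).
Proof. by move=> hX hY i j ij; rewrite submxblockD hX ?hY ?addr0. Qed.

Lemma bandN d k a b (X : 'BM[R]_(k, a, b)) : band d X -> band d (- X).
Proof. by move=> hX i j ij; rewrite submxblockN hX ?oppr0. Qed.

Lemma band_sum d k a b (I : finType) (F : I -> 'BM[R]_(k, a, b)) :
  (forall i, band d (F i)) -> band d (\sum_i F i).
Proof.
move=> hF; elim/big_ind: _ => [i j _||i _]; [exact: submxblock0 | | exact: hF].
by move=> X Y; apply: bandD.
Qed.

Lemma submxblockM k a b c (X : 'BM[R]_(k, a, b)) (Y : 'BM[R]_(k, b, c)) i j :
  submxblock (X *m Y) i j = \sum_l submxblock X i l *m submxblock Y l j.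
Proof.
by rewrite -{1}(submxblockK X) -{1}(submxblockK Y) mul_mxblock mxblockK.
Qed.

Lemma band_mul d e k a b c (X : 'BM[R]_(k, a, b)) (Y : 'BM[R]_(k, b, c)) :
  band d X -> band e Y -> band (d + e) (X *m Y).
Proof.
move=> hX hY i j ij; rewrite submxblockM big1 // => l _.
have [il|li] := ltnP i (l + d); first by rewrite hX // mul0mx.
rewrite hY ?mulmx0 // -(ltn_add2r d) (leq_ltn_trans li) //.
by rewrite -addnA (addnC e).
Qed.

Lemma submxblock1 k a (i j : 'I_k) :
  submxblock (1%:M : 'BM[R]_(k, a, a)) i j = if i == j then 1%:M else 0.
Proof.
apply/matrixP => u v; rewrite !mxE -val_eqE /= tagnat.eq_Rank.
by case: eqP; rewrite !mxE.
Qed.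

Lemma band1 k a : band 0 (1%:M : 'BM[R]_(k, a, a)).
Proof.
move=> i j; rewrite addn0 submxblock1 => ij.
by rewrite -val_eqE (ltn_eqF ij).
Qed.

Lemma band_blkdiag k a b (D : 'I_k -> 'M[R]_(a, b)) : band 0 (blkdiag D).
Proof.
move=> i j; rewrite addn0 /blkdiag mxblockK => ij.
by rewrite -val_eqE (ltn_eqF ij).
Qed.

Lemma band_downshift k n : band 1 (downshift R k n).
Proof.
move=> i j; rewrite addn1 /downshift mxblockK => ij.
by rewrite (ltn_eqF ij).
Qed.

Lemma band_exp k a (N : 'BM[R]_(k, a, a)) l : band 1 N -> band l (N ^+ l).
Proof.
move=> hN; elim: l => [|l IH]; first by rewrite expr0; apply: band1.
by rewrite exprS -mulmxE -add1n; apply: band_mul.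
Qed.

Lemma strictly_lower_nilpotent k a (N : 'BM[R]_(k, a, a)) :
  band 1 N -> N ^+ k = 0.
Proof.
move=> hN; apply/mxblockP => i j; rewrite submxblock0 (band_exp hN) //.
by rewrite (leq_trans (ltn_ord i)) ?leq_addl.
Qed.

(** The inverse is the sum of the powers of N, a series that terminates by
    nilpotency and whose terms are all lower triangular. *)
Lemma unitriangular_inverse k a (N : 'BM[R]_(k, a, a)) :
    band 1 N ->
  (1%:M - N) *m invmx (1%:M - N) = 1%:M /\ band 0 (invmx (1%:M - N)).
Proof.
move=> hN; pose S := \sum_(l < k) N ^+ l.
have WS : (1%:M - N) *m S = 1%:M.
  have := subrX1 N k; rewrite strictly_lower_nilpotent // -/S => NS.
  by rewrite mulmxE idmxE -opprB mulNr -NS opprB subr0.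
have [uW _] := mulmx1_unit WS.
have -> : invmx (1%:M - N) = S by by rewrite -[LHS]mulmx1 -[X in _ *m X]WS mulKmx.
split=> //; apply: band_sum => l; exact/bandW/band_exp.
Qed.

(** * Truncation to the leading blocks *)

Section Leading.

Variables (k : nat) (t : 'I_k).

Lemma leadingE a b (X : 'BM[R]_(k, a, b)) i j :
  submxblock (leading X t) i j =
  submxblock X (widen_ord (ltn_ord t) i) (widen_ord (ltn_ord t) j).
Proof. by rewrite /leading mxblockK. Qed.

Lemma leadingD a b (X Y : 'BM[R]_(k, a, b)) :
  leading (X + Y) t = leading X t + leading Y t.
Proof. by apply/mxblockP => i j; rewrite submxblockD !leadingE submxblockD. Qed.

Lemma leadingN a b (X : 'BM[R]_(k, a, b)) : leading (- X) t = - leading X t.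
Proof. by apply/mxblockP => i j; rewrite submxblockN !leadingE submxblockN. Qed.

Lemma leading1 a : leading (1%:M : 'BM[R]_(k, a, a)) t = 1%:M.
Proof. by apply/mxblockP => i j; rewrite leadingE !submxblock1. Qed.

(** Causality of the left factor alone suffices: its first t + 1 block rows
    vanish beyond block column t, which cuts the sum over the inner index. *)
Lemma leadingM a b c (X : 'BM[R]_(k, a, b)) (Y : 'BM[R]_(k, b, c)) :
  band 0 X -> leading (X *m Y) t = leading X t *m leading Y t.
Proof.
move=> hX; apply/mxblockP => i j; rewrite leadingE !submxblockM.
under [RHS]eq_bigr do rewrite !leadingE.
rewrite (bigID (fun l : 'I_k => (l < t.+1)%N)) /=.
rewrite [X in _ + X]big1 ?addr0 => [|l]; last first.
  rewrite -leqNgt => tl; rewrite hX ?mul0mx // addn0.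
  by rewrite (leq_trans (ltn_ord i)).
by rewrite (big_ord_narrow (ltn_ord t)).
Qed.

(** X(:t) and X'(:t) have right inverses Y(:t) and Y'(:t), and a square matrix
    has a unique inverse.  This is applied with X the inverse of Phi_xx to go
    from controllers to responses, and with X = Phi_xx to come back. *)
Lemma leading_inverse a (X Y X' Y' : 'BM[R]_(k, a, a)) :
    band 0 X -> band 0 X' -> X *m Y = 1%:M -> X' *m Y' = 1%:M ->
  leading X t = leading X' t -> leading Y t = leading Y' t.
Proof.
move=> hX hX' XY XY' eqX.
have E : leading X t *m leading Y t = 1%:M by rewrite -leadingM // XY leading1.
have E' : leading X t *m leading Y' t = 1%:M.
  by rewrite eqX -leadingM // XY' leading1.
by rewrite -[LHS]mulmx1 -E' mulmxA (mulmx1C E) mul1mx.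
Qed.

Lemma eq_leading_blkdiag a b (D D' : 'I_k -> 'M[R]_(a, b)) :
    (forall s : 'I_k, (s <= t)%N -> D s = D' s) ->
  leading (blkdiag D) t = leading (blkdiag D') t.
Proof.
move=> eqD; apply/mxblockP => i j.
by rewrite !leadingE /blkdiag !mxblockK eqD ?leq_ord.
Qed.

End Leading.

End Band.

(** * System responses of a causal controller *)

Lemma sig_prefix_eq T M (sigma sigma' : signal T M) (t s : 'I_T.+1) :
  sig_prefix sigma t = sig_prefix sigma' t -> (s <= t)%N -> sigma s = sigma' s.
Proof.
move=> /ffunP eq_pre st; have := eq_pre (Ordinal (st : (s < t.+1)%N)).
by rewrite !ffunE; congr (sigma _ = sigma' _); apply: val_inj.
Qed.

Section Response.

Variables (R : realType) (T n p m M : nat).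
Variable A : 'I_M -> 'I_T.+1 -> 'M[R]_(n, n).
Variable B : 'I_M -> 'I_T.+1 -> 'M[R]_(n, p).
Variable C : 'I_M -> 'I_T.+1 -> 'M[R]_(m, n).

Local Notation Z := (downshift R T.+1 n).

Definition Phi_xx_inv (sigma : signal T M) (K : 'BM[R]_(T.+1, p, m)) :=
  1%:M - Z *m (blkA A sigma + blkB B sigma *m K *m blkC C sigma).

Section Causal.

Variables (sigma : signal T M) (K : 'BM[R]_(T.+1, p, m)).
Hypothesis Klow : band 0 K.

Lemma band_closed_loop :
  band 1 (Z *m (blkA A sigma + blkB B sigma *m K *m blkC C sigma)).
Proof.
apply: (band_mul (d := 1) (e := 0)); first exact: band_downshift.
apply: bandD; first exact: band_blkdiag.
apply: (band_mul (d := 0) (e := 0)); last exact: band_blkdiag.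
by apply: (band_mul (d := 0) (e := 0)) => //; apply: band_blkdiag.
Qed.

Lemma band_Phi_xx_inv : band 0 (Phi_xx_inv sigma K).
Proof.
apply: bandD; first exact: band1.
exact/bandN/bandW/band_closed_loop.
Qed.

Lemma mul_Phi_xx_inv_Phi_xx : Phi_xx_inv sigma K *m Phi_xx A B C sigma K = 1%:M.
Proof. by have [] := unitriangular_inverse band_closed_loop. Qed.

Lemma band_Phi_xx : band 0 (Phi_xx A B C sigma K).
Proof. by have [] := unitriangular_inverse band_closed_loop. Qed.

Lemma band_Phi_ux : band 0 (Phi_ux A B C sigma K).
Proof.
apply: (band_mul (d := 0) (e := 0)); last exact: band_Phi_xx.
by apply: (band_mul (d := 0) (e := 0)) => //; apply: band_blkdiag.
Qed.

Let Zlow : band 0 Z. Proof. exact/bandW/band_downshift. Qed.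
Let Blow : band 0 (blkB B sigma). Proof. exact: band_blkdiag. Qed.
Let Clow : band 0 (blkC C sigma). Proof. exact: band_blkdiag. Qed.

(* In the proofs below, products are associated to the right so that the left
   factors met by [leadingM] are matrices already known to be causal. *)
Variable t : 'I_T.+1.

Lemma leading_Phi_xx_inv :
  leading (Phi_xx_inv sigma K) t =
  1%:M - leading Z t *m (leading (blkA A sigma) t + leading (blkB B sigma) t *m
                           (leading K t *m leading (blkC C sigma) t)).
Proof.
rewrite /Phi_xx_inv -(mulmxA (blkB _ _)) leadingD leadingN leading1.
rewrite (leadingM t _ Zlow) leadingD (leadingM t _ Blow).
by rewrite (leadingM t _ Klow).
Qed.

Lemma leading_Phi_xy :
  leading (Phi_xy A B C sigma K) t =
  leading (Phi_xx A B C sigma K) t *m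
    (leading Z t *m (leading (blkB B sigma) t *m leading K t)).
Proof.
rewrite /Phi_xy -!mulmxA (leadingM t _ band_Phi_xx) (leadingM t _ Zlow).
by rewrite (leadingM t _ Blow).
Qed.

Lemma leading_Phi_ux :
  leading (Phi_ux A B C sigma K) t =
  leading K t *m
    (leading (blkC C sigma) t *m leading (Phi_xx A B C sigma K) t).
Proof.
by rewrite /Phi_ux -!mulmxA (leadingM t _ Klow) (leadingM t _ Clow).
Qed.

Lemma leading_Phi_uy :
  leading (Phi_uy A B C sigma K) t =
  leading K t + leading (Phi_ux A B C sigma K) t *m
    (leading Z t *m (leading (blkB B sigma) t *m leading K t)).
Proof.
rewrite /Phi_uy leadingD -/(Phi_ux A B C sigma K) -!(mulmxA _ _ K).
rewrite -(mulmxA _ Z) (leadingM t _ band_Phi_ux) (leadingM t _ Zlow).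
by rewrite (leadingM t _ Blow).
Qed.

(** K = Phi_uy - Phi_ux Phi_xx^-1 Phi_xy, truncated: the product telescopes to
    (K C Phi_xx) Phi_xx^-1 (Phi_xx Z B K), the feedback correction in Phi_uy. *)
Lemma leading_controller_of_responses :
  leading K t =
  leading (Phi_uy A B C sigma K) t -
  leading (Phi_ux A B C sigma K) t *m
    (leading (Phi_xx_inv sigma K) t *m leading (Phi_xy A B C sigma K) t).
Proof.
rewrite leading_Phi_uy leading_Phi_xy (mulmxA (leading (Phi_xx_inv _ _) t)).
rewrite -(leadingM t _ band_Phi_xx_inv) mul_Phi_xx_inv_Phi_xx leading1.
by rewrite mul1mx addrK.
Qed.

End Causal.

Section TwoControllers.

Variables (sigma sigma' : signal T M) (K K' : 'BM[R]_(T.+1, p, m)).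
Variable t : 'I_T.+1.
Hypotheses (Klow : band 0 K) (Klow' : band 0 K').
Hypothesis eq_pre : sig_prefix sigma t = sig_prefix sigma' t.

Lemma leading_blkA : leading (blkA A sigma) t = leading (blkA A sigma') t.
Proof.
by apply: eq_leading_blkdiag => s st; rewrite (sig_prefix_eq eq_pre st).
Qed.

Lemma leading_blkB : leading (blkB B sigma) t = leading (blkB B sigma') t.
Proof.
by apply: eq_leading_blkdiag => s st; rewrite (sig_prefix_eq eq_pre st).
Qed.

Lemma leading_blkC : leading (blkC C sigma) t = leading (blkC C sigma') t.
Proof.
by apply: eq_leading_blkdiag => s st; rewrite (sig_prefix_eq eq_pre st).
Qed.

Lemma leading_responses :
    leading K t = leading K' t ->
  [/\ leading (Phi_xx A B C sigma K) t = leading (Phi_xx A B C sigma' K') t,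
      leading (Phi_xy A B C sigma K) t = leading (Phi_xy A B C sigma' K') t,
      leading (Phi_ux A B C sigma K) t = leading (Phi_ux A B C sigma' K') t
    & leading (Phi_uy A B C sigma K) t = leading (Phi_uy A B C sigma' K') t].
Proof.
move=> eqK.
have eqW : leading (Phi_xx_inv sigma K) t = leading (Phi_xx_inv sigma' K') t.
  rewrite (leading_Phi_xx_inv sigma Klow) (leading_Phi_xx_inv sigma' Klow').
  by rewrite leading_blkA leading_blkB leading_blkC eqK.
have eqxx : leading (Phi_xx A B C sigma K) t = leading (Phi_xx A B C sigma' K') t.
  apply: leading_inverse eqW; [exact: band_Phi_xx_inv.. | |];
    exact: mul_Phi_xx_inv_Phi_xx.
have equx : leading (Phi_ux A B C sigma K) t = leading (Phi_ux A B C sigma' K') t.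
  rewrite (leading_Phi_ux sigma Klow) (leading_Phi_ux sigma' Klow').
  by rewrite eqxx leading_blkC eqK.
split; [exact: eqxx | | exact: equx |].
  rewrite (leading_Phi_xy sigma Klow) (leading_Phi_xy sigma' Klow').
  by rewrite eqxx leading_blkB eqK.
rewrite (leading_Phi_uy sigma Klow) (leading_Phi_uy sigma' Klow').
by rewrite equx leading_blkB eqK.
Qed.

Lemma leading_controller :
    leading (Phi_xx A B C sigma K) t = leading (Phi_xx A B C sigma' K') t ->
    leading (Phi_xy A B C sigma K) t = leading (Phi_xy A B C sigma' K') t ->
    leading (Phi_ux A B C sigma K) t = leading (Phi_ux A B C sigma' K') t ->
    leading (Phi_uy A B C sigma K) t = leading (Phi_uy A B C sigma' K') t ->
  leading K t = leading K' t.
Proof.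
move=> eqxx eqxy equx equy.
have eqW : leading (Phi_xx_inv sigma K) t = leading (Phi_xx_inv sigma' K') t.
  apply: leading_inverse eqxx; [exact: band_Phi_xx.. | |];
    exact/mulmx1C/mul_Phi_xx_inv_Phi_xx.
rewrite (leading_controller_of_responses sigma Klow).
by rewrite (leading_controller_of_responses sigma' Klow') eqW eqxy equx equy.
Qed.

End TwoControllers.

End Response.

Theorem proposition1 (R : realType) (T n p m M : nat)
    (A : 'I_M -> 'I_T.+1 -> 'M[R]_(n, n))
    (B : 'I_M -> 'I_T.+1 -> 'M[R]_(n, p))
    (C : 'I_M -> 'I_T.+1 -> 'M[R]_(m, n))
    (L : {set signal T M}) (sigma sigma' : signal T M)
    (sigmaL : sigma \in L) (sigmaL' : sigma' \in L)
    (K K' : 'BM[R]_(T.+1, p, m))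
    (Klow : blk_lower_trig K) (Klow' : blk_lower_trig K') :
  (forall t : 'I_T.+1, sig_prefix sigma t = sig_prefix sigma' t ->
     leading K t = leading K' t)
  <->
  (forall t : 'I_T.+1, sig_prefix sigma t = sig_prefix sigma' t ->
     [/\ leading (Phi_xx A B C sigma K) t = leading (Phi_xx A B C sigma' K') t,
         leading (Phi_xy A B C sigma K) t = leading (Phi_xy A B C sigma' K') t,
         leading (Phi_ux A B C sigma K) t = leading (Phi_ux A B C sigma' K') t
       & leading (Phi_uy A B C sigma K) t = leading (Phi_uy A B C sigma' K') t]).
Proof.
move: Klow Klow' => /band0P low /band0P low'; split=> H t eq_pre.
  exact: leading_responses (H t eq_pre).
by have [] := H t eq_pre; apply: leading_controller.
Qed.
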